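(* Let $A$ be a linear operator on a $2$-dimensional complex Hilbert space, and assume that $A$ is not normal. Put $$V=\operatorname{Re}\operatorname{tr}A,\quad W=|\operatorname{tr}A|^2+2\operatorname{Re}\det A,\quad X=\operatorname{Re}\bigl((\det A)\overline{\operatorname{tr}A}\bigr),\quad Y=|\det A|^2,\quad Z=\operatorname{tr}(A^*A),$$ and $$\mathbf Q=\begin{bmatrix} Z^2-4Y & 2X-VZ & 2VY-XZ\\ 2X-VZ & Z-W+V^2 & \frac{WZ}{2}-VX-\frac{Z^2}{2}\\ 2VY-XZ & \frac{WZ}{2}-VX-\frac{Z^2}{2} & X^2-YW+YZ\end{bmatrix}.$$ Then the conformal range $\mathrm{DW}^{\mathbb R}_{\mathrm{pCK}}(A)$ is exactly the set of $(x,z)\in\mathbb R^2$ satisfying $$\begin{bmatrix} x \\ z \\ 1 \end{bmatrix}^\top\mathbf Q\begin{bmatrix} x \\ z \\ 1 \end{bmatrix}\le 0 .$$ Moreover, the upper left $2\times2$ block of $\mathbf Q$ is positive definite.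
   Context: For a linear operator $A$ on a complex Hilbert space, the conformal range (real Davis--Wielandt shell) in the parabolic Cayley--Klein (pCK) model is $$\mathrm{DW}^{\mathbb R}_{\mathrm{pCK}}(A)=\left\{\left(\frac{\operatorname{Re}\langle A\mathbf x,\mathbf x\rangle}{|\mathbf x|_2^2},\frac{|A\mathbf x|_2^2}{|\mathbf x|_2^2}\right):\mathbf x\ne0\right\}\subset\{(x,z)\in\mathbb R^2: z\ge x^2\}.$$ *)

(* Defs.v *)
From HB Require Import structures.
From mathcomp Require Import all_boot all_order all_algebra.
From mathcomp Require Import sesquilinear complex.
From mathcomp Require Import boolp classical_sets reals.

Set Implicit Arguments.
Unset Strict Implicit.
Unset Printing Implicit Defensive.

Import Order.TTheory GRing.Theory Num.Theory passmx.
Local Open Scope ring_scope.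
Local Open Scope classical_set_scope.

(* A finite-dimensional complex Hilbert space is a vectType V equipped with a
   positive definite Hermitian form f : {dot V for Num.conj}, which is linear
   in its first argument and conjugate-linear in its second; completeness is
   automatic. *)

Section Operators.
Variables (C : numClosedFieldType) (V : vectType C).
Implicit Types A B : 'End(V).

(* This matrix acts on row vectors of coordinates, so it is the transpose of
   the usual one; trace and determinant are not affected. *)
Definition lmatrix A : 'M[C]_(\dim {:V}) :=
  mxof (vbasis {:V}) (vbasis {:V}) A.

Definition ltrace A : C := \tr (lmatrix A).
Definition ldet A : C := \det (lmatrix A).

Lemma ltrace_ldet_basis A (e : (\dim {:V}).-tuple V) : basis_of {:V} e ->
  ltrace A = \tr (mxof e e A) /\ ldet A = \det (mxof e e A).
Proof.
move=> be; have bv := vbasisP {:V}.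
pose P := mxof (vbasis {:V}) e \1%VF; pose Q := mxof e (vbasis {:V}) \1%VF.
have PQ : P *m Q = 1%:M.
  by rewrite -(mxof_comp _ _ be) comp_lfun1l mxof1 // (basis_free bv).
have -> : mxof e e A = Q *m lmatrix A *m P.
  by rewrite -!(mxof_comp _ _ bv) comp_lfun1l comp_lfun1r.
split; first by rewrite mxtrace_mulC mulmxA PQ mul1mx.
by rewrite !det_mulmx mulrAC [\det Q * _]mulrC -det_mulmx PQ det1 mul1r.
Qed.

Variable f : {dot V for Num.conj}.

Definition is_adjoint A B := forall u v, f (A u) v = f u (B v).

Definition adjoint A : 'End(V) := xget 0 [set B | is_adjoint A B].

Definition normal_op A := (A \o adjoint A)%VF = (adjoint A \o A)%VF.

Lemma is_adjoint_exists A : exists B, is_adjoint A B.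
Proof.
pose n := \dim {:V}; pose e := vbasis {:V}.
have be : basis_of {:V} e := vbasisP _.
pose G : 'M[C]_n := \matrix_(i, j) f e`_i e`_j.
have fE (u v : 'rV[C]_n) :
    f (vecof e u) (vecof e v) = (u *m G *m (map_mx Num.conj v)^T) 0 0.
  rewrite /vecof linear_sumlz mxE.
  under eq_bigr => i _ do rewrite linear_sumr.
  rewrite exchange_big; apply: eq_bigr => j _ /=.
  rewrite !mxE mulr_suml; apply: eq_bigr => i _ /=.
  by rewrite mxE linearZl_LR linearZr_LR /= -!mulrA; congr (_ * _); rewrite mulrC.
have uG : G \in unitmx.
  rewrite -row_free_unit; apply: inj_row_free => u uG0.
  apply/eqP; rewrite -(vecof_eq0 be) -(dnorm_eq0 f).
  by rewrite fE uG0 mul0mx mxE.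
pose M := mxof e e A.
exists (hommx e e (map_mx Num.conj (invmx G *m M *m G))^T) => x y.
rewrite -(rVofK be x) -(rVofK be y) (hom_vecof _ be) -vecof_mul // !fE.
congr (fun_of_matrix _ 0 0).
rewrite map_mxM trmx_mul -map_trmx trmxK -map_mx_comp.
rewrite [map_mx (_ \o _) _]map_mx_id; last by move=> z /=; rewrite conjCK.
by rewrite !mulmxA mulmxK.
Qed.

Lemma adjointP A u v : f (A u) v = f u (adjoint A v).
Proof. exact: (xgetPex 0 (is_adjoint_exists A)). Qed.

Lemma adjoint_uniq A B : is_adjoint A B -> B = adjoint A.
Proof.
move=> AB; apply/lfunP => v; apply/eqP; rewrite -subr_eq0 -(dnorm_eq0 f).
by rewrite linearBr /= -AB -adjointP subrr.
Qed.

End Operators.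

Definition posdefmx (R : realType) n (M : 'M[R]_n) :=
  M^T = M /\ forall v : 'cV[R]_n, v != 0 -> 0 < (v^T *m M *m v) 0 0.

Section ConformalRange.
Variables (R : realType) (V : vectType R[i]) (f : {dot V for Num.conj}).
Implicit Types A : 'End(V).

Definition sqnorm (u : V) : R := complex.Re (f u u).

Definition DWR_pCK A : set (R * R) :=
  [set p | exists2 u : V, u != 0 &
    p = (complex.Re (f (A u) u) / sqnorm u, sqnorm (A u) / sqnorm u)].

Definition sqmod (z : R[i]) : R := ComplexField.Normc.normc z ^+ 2.

Definition invV A : R := complex.Re (ltrace A).
Definition invW A : R := sqmod (ltrace A) + 2 * complex.Re (ldet A).
Definition invX A : R := complex.Re (ldet A * Num.conj (ltrace A)).
Definition invY A : R := sqmod (ldet A).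
(* The trace of A^* A is real: it is the sum of the squared norms of the images
   of the vectors of an orthonormal basis. *)
Definition invZ A : R := complex.Re (ltrace (adjoint f A \o A)%VF).

(* The size is written 2 + 1 so that ulsubmx extracts the 2 x 2 block. *)
Definition Qmx A : 'M[R]_(2 + 1) :=
  let V := invV A in let W := invW A in let X := invX A in
  let Y := invY A in let Z := invZ A in
  let rows :=
    [:: [:: Z ^+ 2 - 4 * Y;  2 * X - V * Z;  2 * V * Y - X * Z];
        [:: 2 * X - V * Z;  Z - W + V ^+ 2;  W * Z / 2 - V * X - Z ^+ 2 / 2];
        [:: 2 * V * Y - X * Z;  W * Z / 2 - V * X - Z ^+ 2 / 2;
            X ^+ 2 - Y * W + Y * Z]] in
  \matrix_(i, j) (nth [::] rows i)`_j.

Definition homog (x z : R) : 'cV[R]_(2 + 1) := \col_i [:: x; z; 1]`_i.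

End ConformalRange.

(* Main.v *)
(* In an orthonormal basis write A = m_0 + m . sigma with m_0 = a_0 + i b_0 and
   m = a + i b in Pauli coordinates. Then Re A = a_0 + a . sigma and
   A^* A = h + v . sigma, so the conformal range is the image of the Bloch
   sphere under n |-> (a_0 + a . n, h + v . n). Let G be the Gram matrix of
   (a, v). If det G > 0, this image is the filled ellipse
   w^T (adj G) w <= det G with w = (x - a_0, z - h), and the form of Q is
   4 (w^T (adj G) w - det G). Finally
   det G = 4 (b_0^2 + |a|^2) |a x b|^2, which vanishes only if a x b = 0, that
   is, only if A is normal. *)
Require Import Defs.
From mathcomp Require Import all_boot all_order all_algebra.
From mathcomp Require Import sesquilinear complex.
From mathcomp Require Import boolp classical_sets reals.
From mathcomp Require Import ring lra.

Set Implicit Arguments.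
Unset Strict Implicit.
Unset Printing Implicit Defensive.

Import Order.TTheory GRing.Theory Num.Theory passmx.
Local Open Scope ring_scope.
Local Open Scope complex_scope.
Local Open Scope classical_set_scope.

(** * Linear images of the unit sphere, and the Hopf map *)

Lemma disk_sphere_image (R : rcfType) (u1 u2 u3 v1 v2 v3 p q : R) :
  let g11 := u1 ^+ 2 + u2 ^+ 2 + u3 ^+ 2 in
  let g12 := u1 * v1 + u2 * v2 + u3 * v3 in
  let g22 := v1 ^+ 2 + v2 ^+ 2 + v3 ^+ 2 in
  0 < g11 * g22 - g12 ^+ 2 ->
  (exists n1 n2 n3 : R, [/\ n1 ^+ 2 + n2 ^+ 2 + n3 ^+ 2 = 1,
      p = u1 * n1 + u2 * n2 + u3 * n3 & q = v1 * n1 + v2 * n2 + v3 * n3])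
  <-> g22 * p ^+ 2 - 2 * g12 * p * q + g11 * q ^+ 2 <= g11 * g22 - g12 ^+ 2.
Proof.
move=> g11 g12 g22 D_gt0.
(* The vector w = u x v; [DE] is Lagrange's identity for its squared length. *)
pose w1 := u2 * v3 - u3 * v2; pose w2 := u3 * v1 - u1 * v3.
pose w3 := u1 * v2 - u2 * v1.
have DE : w1 ^+ 2 + w2 ^+ 2 + w3 ^+ 2 = g11 * g22 - g12 ^+ 2.
  by rewrite /w1 /w2 /w3 /g11 /g12 /g22; ring.
split=> [[n1 [n2 [n3 [n_unit -> ->]]]]|].
  rewrite -subr_ge0 -[g11 * g22 - _]mulr1 -[X in _ * X - _]n_unit.
  (* The difference is the Gram determinant of [u], [v] and [n]. *)
  suff -> : (g11 * g22 - g12 ^+ 2) * (n1 ^+ 2 + n2 ^+ 2 + n3 ^+ 2)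
      - (g22 * (u1 * n1 + u2 * n2 + u3 * n3) ^+ 2
      - 2 * g12 * (u1 * n1 + u2 * n2 + u3 * n3) * (v1 * n1 + v2 * n2 + v3 * n3)
      + g11 * (v1 * n1 + v2 * n2 + v3 * n3) ^+ 2) =
    (w1 * n1 + w2 * n2 + w3 * n3) ^+ 2 by exact: sqr_ge0.
  by rewrite /w1 /w2 /w3 /g11 /g12 /g22; ring.
rewrite -subr_ge0 => pq.
have D0 : g11 * g22 - g12 ^+ 2 != 0 by rewrite gt_eqF.
(* By Cramer's rule, al u + be v is the vector of the plane of u and v whose inner products with u
   and v are p and q. Its squared length falls short of 1 by d / det G, where det G is also |w|^2.
   The summand c w, orthogonal to u and v, makes up for this. *)
pose al := (g22 * p - g12 * q) / (g11 * g22 - g12 ^+ 2).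
pose be := (g11 * q - g12 * p) / (g11 * g22 - g12 ^+ 2).
pose d := g11 * g22 - g12 ^+ 2
  - (g22 * p ^+ 2 - 2 * g12 * p * q + g11 * q ^+ 2).
pose c := Num.sqrt d / (g11 * g22 - g12 ^+ 2).
have c2 : c ^+ 2 = d / (g11 * g22 - g12 ^+ 2) ^+ 2.
  by rewrite expr_div_n sqr_sqrtr.
have pE : al * g11 + be * g12 = p by rewrite /al /be; field.
have qE : al * g12 + be * g22 = q by rewrite /al /be; field.
exists (al * u1 + be * v1 + c * w1), (al * u2 + be * v2 + c * w2),
  (al * u3 + be * v3 + c * w3); split.
- transitivity (al * (al * g11 + be * g12) + be * (al * g12 + be * g22)
    + c ^+ 2 * (w1 ^+ 2 + w2 ^+ 2 + w3 ^+ 2)).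
    by rewrite /w1 /w2 /w3 /g11 /g12 /g22; ring.
  by rewrite pE qE c2 DE /al /be /d; field.
- by rewrite -[LHS]pE /w1 /w2 /w3 /g11 /g12; ring.
- by rewrite -[LHS]qE /w1 /w2 /w3 /g12 /g22; ring.
Qed.

(** Stereographic projection: the spinor (1 + n3, n1 + i n2) lies over n. It vanishes at the south
    pole, where (0, 1) replaces it. Leaving the spinor unnormalized avoids square roots. *)
Lemma hopf_surjective (R : rcfType) (n1 n2 n3 : R) :
  n1 ^+ 2 + n2 ^+ 2 + n3 ^+ 2 = 1 ->
  exists s1 s2 t1 t2 : R,
   let N := s1 ^+ 2 + s2 ^+ 2 + t1 ^+ 2 + t2 ^+ 2 in
   [/\ N != 0, N * n1 = 2 * (s1 * t1 + s2 * t2),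
       N * n2 = 2 * (s1 * t2 - s2 * t1) &
       N * n3 = s1 ^+ 2 + s2 ^+ 2 - t1 ^+ 2 - t2 ^+ 2].
Proof.
move=> n_unit; have [n3N1|n3N1] := eqVneq n3 (-1).
  have [n10 n20] : n1 = 0 /\ n2 = 0.
    suff /eqP : n1 ^+ 2 + n2 ^+ 2 = 0.
      by rewrite paddr_eq0 ?sqr_ge0 // !sqrf_eq0 => /andP[/eqP ? /eqP].
    by move: n_unit; rewrite n3N1; lra.
  exists 0, 0, 1, 0; rewrite n10 n20 n3N1 /=; split; try by ring.
  by rewrite !expr0n /= expr1n !add0r addr0 oner_eq0.
exists (1 + n3), 0, n1, n2 => N.
have NE : N = 2 * (1 + n3).
  have -> : N = 2 * (1 + n3) + (n1 ^+ 2 + n2 ^+ 2 + n3 ^+ 2 - 1).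
    by rewrite /N; ring.
  by rewrite n_unit subrr addr0.
split; rewrite NE; try by ring.
  by rewrite mulf_neq0 ?pnatr_eq0 // addrC -[1]opprK subr_eq0.
have -> : n2 ^+ 2 = 1 - n1 ^+ 2 - n3 ^+ 2 by rewrite -n_unit; ring.
ring.
Qed.

(** The determinant forces g22 > 0; multiplying by g22 then allows the square to be completed. *)
Lemma quadratic_gt0 (R : realDomainType) (g11 g12 g22 x y : R) :
  0 <= g22 -> 0 < g11 * g22 - g12 ^+ 2 -> (x != 0) || (y != 0) ->
  0 < g22 * x ^+ 2 - 2 * g12 * x * y + g11 * y ^+ 2.
Proof.
move=> g22_ge0 D_gt0 xy.
have g22_gt0 : 0 < g22.
  rewrite lt_def g22_ge0 andbT; apply: contraTneq D_gt0 => ->.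
  by rewrite mulr0 sub0r oppr_gt0 -leNgt sqr_ge0.
rewrite -(pmulr_rgt0 _ g22_gt0).
have -> : g22 * (g22 * x ^+ 2 - 2 * g12 * x * y + g11 * y ^+ 2) =
  (g22 * x - g12 * y) ^+ 2 + (g11 * g22 - g12 ^+ 2) * y ^+ 2 by ring.
have [y0|y_neq0] := eqVneq y 0; last first.
  by rewrite ltr_wpDl ?sqr_ge0 // mulr_gt0 // exprn_even_gt0.
move: xy; rewrite y0 eqxx orbF => x_neq0.
by rewrite expr0n /= !mulr0 subr0 addr0 exprn_even_gt0 //= mulf_neq0 // gt_eqF.
Qed.

(** * Matrix expressions in coordinates *)

Lemma quad_formE (R : pzRingType) n (M : 'M[R]_n) (w : 'cV[R]_n) :
  (w^T *m M *m w) 0 0 = \sum_j \sum_i w i 0 * M i j * w j 0.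
Proof.
rewrite mxE; apply: eq_bigr => j _; rewrite mxE mulr_suml.
by apply: eq_bigr => i _; rewrite mxE.
Qed.

(** The size will be [\dim {:V}], equal to 2 only by hypothesis, so indices are transported by
    [cast_ord]. *)
Lemma mxtrace_mx22 (K : pzSemiRingType) n (M : 'M[K]_n) (n_eq2 : n = 2%N) :
  let k := cast_ord (esym n_eq2) in \tr M = M (k 0) (k 0) + M (k 1) (k 1).
Proof.
subst n => k; rewrite /mxtrace big_ord_recl big_ord1.
by congr (M _ _ + M _ _); apply: val_inj.
Qed.

Lemma det_mx22 (K : comPzRingType) n (M : 'M[K]_n) (n_eq2 : n = 2%N) :
  let k := cast_ord (esym n_eq2) in
  \det M = M (k 0) (k 0) * M (k 1) (k 1) - M (k 0) (k 1) * M (k 1) (k 0).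
Proof.
subst n => k; rewrite (expand_det_row _ 0) big_ord_recl big_ord1.
rewrite /cofactor !det_mx11 !mxE /= expr0 expr1 mul1r mulN1r mulrN.
by congr (M _ _ * M _ _ - M _ _ * M _ _); apply: val_inj.
Qed.

(** * Operators in an orthonormal basis of a plane *)

Section Orthonormal2.
Variables (C : numClosedFieldType) (V : vectType C).
Variable f : {dot V for Num.conj}.
Hypothesis dimV : \dim {:V} = 2%N.

(** Gram-Schmidt, applied to a nonzero vector x and a vector y off the line of x. *)
Lemma orthonormal2_exists : exists e1 e2, orthonormal f [:: e1; e2].
Proof.
have normalize (u : V) : u != 0 ->
    f ((sqrtC (f u u))^-1 *: u) ((sqrtC (f u u))^-1 *: u) = 1.
  move=> u0; rewrite dnormZ normfV ger0_norm ?sqrt_dnorm_ge0 //.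
  by rewrite exprVn sqrtCK mulVf // dnorm_eq0.
have V0 : vpick {:V} != 0 by rewrite vpick0 -dimv_eq0 dimV.
set x := vpick {:V} in V0.
have [y _ yx] : exists2 y, y \in {:V}%VS & y \notin <[x]>%VS.
  by apply/subvPn; apply/negP => /dimvS; rewrite dimV dim_vline V0.
pose z := y - (f y x / f x x) *: x.
have z0 : z != 0.
  apply: contraNneq yx => /eqP; rewrite subr_eq0 => /eqP ->.
  by rewrite memvZ ?memv_line.
have zx : f x z = 0.
  apply/eqP; rewrite herm_eq0C linearBl linearZl_LR /= divfK ?subrr //.
  by rewrite dnorm_eq0.
exists ((sqrtC (f x x))^-1 *: x), ((sqrtC (f z z))^-1 *: z).
apply/orthonormal2P; split; try exact: normalize.
by rewrite linearZl_LR linearZr_LR /= zx !mulr0.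
Qed.

Variables (e1 e2 : V).
Hypothesis on : orthonormal f [:: e1; e2].

Lemma orthonormal2_basis : basis_of {:V} [:: e1; e2].
Proof. by rewrite basisEfree (orthonormal_free on) subvf dimV. Qed.

Lemma orthonormal2_decomp u : u = f u e1 *: e1 + f u e2 *: e2.
Proof.
have /orthonormal2P[e12 e11 e22] := on.
have e21 : f e2 e1 = 0 by apply/eqP; rewrite herm_eq0C; apply/eqP.
have be : basis_of {:V} (in_tuple [:: e1; e2]) := orthonormal2_basis.
have := coord_basis be (memvf u).
rewrite big_ord_recl big_ord1 /=; set a := coord _ _ _; set b := coord _ _ _.
move=> ->; rewrite !linearDl !linearZl_LR /= e11 e12 e21 e22.
by rewrite !mulr0 !mulr1 addr0 add0r.
Qed.

(** Trace and determinant may be computed in any basis, and in an orthonormal one the matrix entries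
    are inner products. *)
Lemma ltrace_ldet_orthonormal2 (A : 'End(V)) :
  ltrace A = f (A e1) e1 + f (A e2) e2 /\
  ldet A = f (A e1) e1 * f (A e2) e2 - f (A e1) e2 * f (A e2) e1.
Proof.
have sz : size [:: e1; e2] == \dim {:V} by rewrite dimV.
pose e : (\dim {:V}).-tuple V := Tuple sz.
have be : basis_of {:V} e := orthonormal2_basis.
have /orthonormal2P[e12 e11 e22] := on.
have e21 : f e2 e1 = 0 by apply/eqP; rewrite herm_eq0C; apply/eqP.
pose k := cast_ord (esym dimV).
have ek0 : e`_(k 0) = e1 by [].
have ek1 : e`_(k 1) = e2 by [].
have k01 (j : 'I_2) : j = 0 \/ j = 1.
  by case: j => [[|[|//]] ?]; [left|right]; apply: val_inj.
have onk (i j : 'I_2) : f e`_(k i) e`_(k j) = (i == j)%:R.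
  by case: (k01 i) => ->; case: (k01 j) => ->; rewrite ?ek0 ?ek1.
have mxE2 (i j : 'I_2) : mxof e e A (k i) (k j) = f (A e`_(k i)) e`_(k j).
  rewrite /mxof mxE /= vecof_delta mxE.
  rewrite [in RHS](coord_basis be (memvf (A e`_(k i)))) linear_sumlz.
  rewrite (bigD1 (k j)) //= linearZl_LR /= onk eqxx mulr1 big1 ?addr0 // => l lj.
  (* Every index comes from ['I_2], which brings the remaining terms under [onk]. *)
  have lE : l = k (cast_ord dimV l) by apply: val_inj.
  have fl : f e`_l e`_(k j) = 0.
    rewrite lE onk; suff /negPf -> : cast_ord dimV l != j by [].
    by apply: contraNneq lj => <-; rewrite -lE.
  by rewrite linearZl_LR /= fl mulr0.
have [-> ->] := ltrace_ldet_basis A be.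
by rewrite (@mxtrace_mx22 _ _ _ dimV) (@det_mx22 _ _ _ dimV) -/k !mxE2 ek0 ek1.
Qed.

End Orthonormal2.

Section Parseval.
Variables (C : numClosedFieldType) (V : vectType C).
Variable f : {dot V for Num.conj}.
Hypothesis dimV : \dim {:V} = 2%N.
Variables (e1 e2 : V).
Hypothesis on : orthonormal f [:: e1; e2].
Variable A : 'End(V).

Lemma dot_conj u v : f u v = (f v u)^*%R.
Proof. by rewrite (hermC f u v) expr0 mul1r. Qed.

Lemma dot_orthonormal2 u v :
  f u v = f u e1 * (f v e1)^*%R + f u e2 * (f v e2)^*%R.
Proof.
rewrite {1}(orthonormal2_decomp dimV on v) linearDr !linearZr_LR /=.
by rewrite mulrC; congr (_ + _); rewrite mulrC.
Qed.

Lemma ltrace_adjoint_comp :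
  ltrace (adjoint f A \o A)%VF = f (A e1) (A e1) + f (A e2) (A e2).
Proof.
have [-> _] := ltrace_ldet_orthonormal2 dimV on (adjoint f A \o A)%VF.
rewrite !lfunE /= !(dot_conj (adjoint f A _)) -!adjointP.
by rewrite -!dot_conj.
Qed.

(** The two sides of the hypothesis are the matrix entries of A^* A and A A^*. *)
Lemma normal_op_orthonormal2 :
  (forall i j, i \in [:: e1; e2] -> j \in [:: e1; e2] ->
     f (A i) (A j) = f (adjoint f A i) (adjoint f A j)) ->
  normal_op f A.
Proof.
move=> AA; apply/lfunP => u.
have AAe i j : i \in [:: e1; e2] -> j \in [:: e1; e2] ->
    f (A (adjoint f A i)) j = f (adjoint f A (A i)) j.
  move=> ei ej; rewrite adjointP -AA // [RHS]dot_conj -adjointP.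
  by rewrite -dot_conj.
suff AAi i : i \in [:: e1; e2] -> A (adjoint f A i) = adjoint f A (A i).
  rewrite !lfunE /= (orthonormal2_decomp dimV on u) !linearD !linearZ /=.
  by rewrite !AAi // !inE eqxx ?orbT.
move=> ei; rewrite [LHS](orthonormal2_decomp dimV on).
rewrite [RHS](orthonormal2_decomp dimV on).
by rewrite !AAe // !inE eqxx ?orbT.
Qed.

End Parseval.

Lemma tr_Qmx (R : realType) (V : vectType R[i]) (f : {dot V for Num.conj})
  (A : 'End(V)) : (Qmx f A)^T = Qmx f A.
Proof.
apply/matrixP => i j; rewrite !mxE.
by case: i j => [[|[|[|//]]] ?] [[|[|[|//]]] ?].
Qed.

(** * Computations in Pauli coordinates *)

Section Pauli.
Variables (R : realType) (V : vectType R[i]) (f : {dot V for Num.conj}).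
Hypothesis dimV : \dim {:V} = 2%N.
Variables (e1 e2 : V).
Hypothesis on : orthonormal f [:: e1; e2].
Variable A : 'End(V).
Variables a0 a1 a2 a3 b0 b1 b2 b3 : R.
(* The Pauli coordinates of [A] are a_k + i b_k; the second Pauli matrix is
   transposed because [f (A e_i) e_j] is the (j, i) entry of the usual matrix. *)
Hypothesis m11 : f (A e1) e1 = (a0 + a3) +i* (b0 + b3).
Hypothesis m12 : f (A e1) e2 = (a1 - b2) +i* (a2 + b1).
Hypothesis m21 : f (A e2) e1 = (a1 + b2) +i* (b1 - a2).
Hypothesis m22 : f (A e2) e2 = (a0 - a3) +i* (b0 - b3).

(* With [a] = (a1, a2, a3) and [b] = (b1, b2, b3), these are the Pauli
   coordinates of A^* A: [h] is half its trace and
   [v] = 2 (a0 a + b0 b - a x b). *)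
Let h := a0 ^+ 2 + a1 ^+ 2 + a2 ^+ 2 + a3 ^+ 2
       + b0 ^+ 2 + b1 ^+ 2 + b2 ^+ 2 + b3 ^+ 2.
Let v1 := 2 * (a0 * a1 + b0 * b1 - (a2 * b3 - a3 * b2)).
Let v2 := 2 * (a0 * a2 + b0 * b2 - (a3 * b1 - a1 * b3)).
Let v3 := 2 * (a0 * a3 + b0 * b3 - (a1 * b2 - a2 * b1)).

Lemma conj_complex (x y : R) : (x +i* y)^*%R = x -i* y.
Proof. by []. Qed.

Lemma dot_image11 : f (A e1) (A e1) = (h + v3)%:C.
Proof.
rewrite (dot_orthonormal2 dimV on) m11 m12 !conj_complex; simpc.
by congr (_ +i* _); rewrite /h /v3; ring.
Qed.

Lemma dot_image12 : f (A e1) (A e2) = v1 +i* v2.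
Proof.
rewrite (dot_orthonormal2 dimV on) m11 m12 m21 m22 !conj_complex; simpc.
by congr (_ +i* _); rewrite /v1 /v2; ring.
Qed.

Lemma dot_image22 : f (A e2) (A e2) = (h - v3)%:C.
Proof.
rewrite (dot_orthonormal2 dimV on) m21 m22 !conj_complex; simpc.
by congr (_ +i* _); rewrite /h /v3; ring.
Qed.

(** The hypotheses say a x b = 0, and A A^* - A^* A = 4 (a x b) . sigma. *)
Lemma normal_pauli : a2 * b3 = a3 * b2 -> a3 * b1 = a1 * b3 ->
  a1 * b2 = a2 * b1 -> normal_op f A.
Proof.
move=> c1 c2 c3; apply: (normal_op_orthonormal2 dimV on).
have adjE i j : f (adjoint f A i) j = (f (A j) i)^*%R.
  by rewrite [LHS]dot_conj adjointP.
move=> i j; rewrite !inE => /orP[] /eqP -> /orP[] /eqP ->;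
  rewrite [LHS](dot_orthonormal2 dimV on) [RHS](dot_orthonormal2 dimV on);
  rewrite !adjE ?m11 ?m12 ?m21 ?m22 !conj_complex; simpc;
  congr (_ +i* _); lra.
Qed.

Section Vector.
Variables s1 s2 t1 t2 : R.
Let u := (s1 +i* s2) *: e1 + (t1 +i* t2) *: e2.
Let N := s1 ^+ 2 + s2 ^+ 2 + t1 ^+ 2 + t2 ^+ 2.
(** For nonzero [u], (n1, n2, n3) is [N] times the Bloch vector of [u]. *)
Let n1 := 2 * (s1 * t1 + s2 * t2).
Let n2 := 2 * (s1 * t2 - s2 * t1).
Let n3 := s1 ^+ 2 + s2 ^+ 2 - t1 ^+ 2 - t2 ^+ 2.

Let AuE : A u = (s1 +i* s2) *: A e1 + (t1 +i* t2) *: A e2.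
Proof. by rewrite /u linearD !linearZ. Qed.

Lemma sqnorm_pauli : sqnorm f u = N.
Proof.
have /orthonormal2P[e12 e11 e22] := on.
have e21 : f e2 e1 = 0 by apply/eqP; rewrite herm_eq0C; apply/eqP.
rewrite /sqnorm /u !linearDl !linearDr !linearZl_LR !linearZr_LR /=.
by rewrite e11 e12 e21 e22 !conj_complex; simpc; rewrite /= /N; ring.
Qed.

Lemma Re_dot_pauli :
  complex.Re (f (A u) u) = N * a0 + (a1 * n1 + a2 * n2 + a3 * n3).
Proof.
rewrite AuE /u !linearDl !linearDr !linearZl_LR !linearZr_LR /=.
rewrite m11 m12 m21 m22 !conj_complex; simpc.
by rewrite /= /N /n1 /n2 /n3; ring.
Qed.

Lemma sqnorm_image_pauli :
  sqnorm f (A u) = N * h + (v1 * n1 + v2 * n2 + v3 * n3).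
Proof.
have dot_image21 : f (A e2) (A e1) = v1 -i* v2.
  by rewrite [LHS]dot_conj dot_image12.
rewrite /sqnorm AuE !linearDl !linearDr.
rewrite !linearZl_LR !linearZr_LR /=.
rewrite dot_image11 dot_image12 dot_image21 dot_image22 !conj_complex; simpc.
by rewrite /= /N /n1 /n2 /n3; ring.
Qed.

End Vector.

(** * The invariants and the form of Q *)

Let g11 := a1 ^+ 2 + a2 ^+ 2 + a3 ^+ 2.
Let g12 := a1 * v1 + a2 * v2 + a3 * v3.
Let g22 := v1 ^+ 2 + v2 ^+ 2 + v3 ^+ 2.

Lemma sqmod_complex (x y : R) : sqmod (x +i* y) = x ^+ 2 + y ^+ 2.
Proof. by rewrite /sqmod /= sqr_sqrtr // addr_ge0 ?sqr_ge0. Qed.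

Lemma ltrace_pauli : ltrace A = (2 * a0) +i* (2 * b0).
Proof.
have [-> _] := ltrace_ldet_orthonormal2 dimV on A; rewrite m11 m22; simpc.
by congr (_ +i* _); ring.
Qed.

Lemma ldet_pauli : ldet A =
  (a0 ^+ 2 - b0 ^+ 2 - g11 + (b1 ^+ 2 + b2 ^+ 2 + b3 ^+ 2))
  +i* (2 * (a0 * b0 - (a1 * b1 + a2 * b2 + a3 * b3))).
Proof.
have [_ ->] := ltrace_ldet_orthonormal2 dimV on A; rewrite m11 m12 m21 m22.
by simpc; congr (_ +i* _); rewrite /g11; ring.
Qed.

(** This and the next four lemmas express the invariants, and so Q, through a0, h and the entries of
    G alone. *)
Lemma invV_pauli : invV A = 2 * a0.
Proof. by rewrite /invV ltrace_pauli. Qed.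

Lemma invZ_pauli : invZ f A = 2 * h.
Proof.
by rewrite /invZ (ltrace_adjoint_comp dimV on) dot_image11 dot_image22 /=; ring.
Qed.

Lemma invW_pauli : invW A = 2 * h + 4 * a0 ^+ 2 - 4 * g11.
Proof.
by rewrite /invW ltrace_pauli ldet_pauli sqmod_complex /= /h /g11; ring.
Qed.

Lemma invX_pauli : invX A = 2 * (a0 * h - g12).
Proof.
rewrite /invX ltrace_pauli ldet_pauli conj_complex; simpc.
by rewrite /= /h /g11 /g12 /v1 /v2 /v3; ring.
Qed.

(** Here |det A|^2 = det (A^* A), and h + v . sigma has determinant h^2 - |v|^2. *)
Lemma invY_pauli : invY A = h ^+ 2 - g22.
Proof.
by rewrite /invY ldet_pauli sqmod_complex /h /g11 /g22 /v1 /v2 /v3; ring.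
Qed.

(* This is |a x v|^2, where a x v = 2 b0 (a x b) - 2 a x (a x b) is an
   orthogonal sum. *)
Lemma gram_pauli : g11 * g22 - g12 ^+ 2 =
  4 * (b0 ^+ 2 + a1 ^+ 2 + a2 ^+ 2 + a3 ^+ 2) *
  ((a2 * b3 - a3 * b2) ^+ 2 + (a3 * b1 - a1 * b3) ^+ 2
   + (a1 * b2 - a2 * b1) ^+ 2).
Proof. by rewrite /g11 /g12 /g22 /v1 /v2 /v3; ring. Qed.

Lemma gram_gt0 : ~ normal_op f A -> 0 < g11 * g22 - g12 ^+ 2.
Proof.
move=> nA; rewrite gram_pauli lt_def !mulr_ge0 ?addr_ge0 ?sqr_ge0 // andbT.
apply/negP; rewrite !mulf_eq0 pnatr_eq0 /=.
rewrite !paddr_eq0 ?addr_ge0 ?sqr_ge0 // !sqrf_eq0 !subr_eq0.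
(* If the first factor vanishes then a = 0, so a x b = 0 in both cases. *)
case/orP => [/andP[/andP[/andP[_ /eqP a10] /eqP a20] /eqP a30]|].
  by apply: nA; apply: normal_pauli; rewrite ?a10 ?a20 ?a30 !mul0r.
by case/andP=> /andP[/eqP ? /eqP ?] /eqP ?; apply/nA/normal_pauli.
Qed.

Lemma Qmx_form_pauli x z :
  ((homog x z)^T *m Qmx f A *m homog x z) 0 0 =
  4 * (g22 * (x - a0) ^+ 2 - 2 * g12 * (x - a0) * (z - h)
       + g11 * (z - h) ^+ 2 - (g11 * g22 - g12 ^+ 2)).
Proof.
(* Giving the size 2 lets ['I_(2 + 1)] be read as ['I_3]. *)
rewrite quad_formE; do ?[rewrite (@big_ord_recl _ _ _ 2) /=].
rewrite !big_ord_recl !big_ord0 /=.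
rewrite !mxE /= invV_pauli invZ_pauli invW_pauli invX_pauli invY_pauli.
by field.
Qed.

(** The block is 4 adj G, the matrix of the quadratic part of the full form. *)
Lemma Qmx_block_pauli (w : 'cV[R]_2) :
  (w^T *m ulsubmx (Qmx f A) *m w) 0 0 =
  4 * (g22 * w 0 0 ^+ 2 - 2 * g12 * w 0 0 * w 1 0 + g11 * w 1 0 ^+ 2).
Proof.
rewrite quad_formE !big_ord_recl !big_ord0 /= !mxE /=.
rewrite invV_pauli invZ_pauli invW_pauli invX_pauli invY_pauli.
have -> : lift ord0 ord0 = 1 :> 'I_2 by apply: val_inj.
by field.
Qed.

(** * The conformal range and positive definiteness *)

Lemma DWR_pCK_pauli : ~ normal_op f A ->
  DWR_pCK f A =
    [set p : R * R |
       ((homog p.1 p.2)^T *m Qmx f A *m homog p.1 p.2) 0 0 <= 0].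
Proof.
move=> nA; have D_gt0 := gram_gt0 nA; rewrite predeqE => -[x z] /=.
rewrite Qmx_form_pauli pmulr_rle0 ?ltr0n // subr_le0.
rewrite -(@disk_sphere_image _ a1 a2 a3 v1 v2 v3) //; split.
  case=> u u0 [-> ->]; have := u0.
  rewrite (orthonormal2_decomp dimV on u).
  case: (f u e1) (f u e2) => [s1 s2] [t1 t2] {u u0} u0.
  set N := s1 ^+ 2 + s2 ^+ 2 + t1 ^+ 2 + t2 ^+ 2.
  (* [sqnorm] keeps only the real part of [f u u]; the imaginary part vanishes since [f u u] is
     nonnegative. *)
  have N0 : N != 0.
    rewrite /N -sqnorm_pauli /sqnorm; apply: contraNneq u0 => Re0.
    have := dnorm_ge0 f ((s1 +i* s2) *: e1 + (t1 +i* t2) *: e2).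
    rewrite -(dnorm_eq0 f) eq_complex Re0 eqxx => /ger0_Im ->.
    by rewrite eqxx.
  (* The Bloch vector of [u]. *)
  exists (2 * (s1 * t1 + s2 * t2) / N), (2 * (s1 * t2 - s2 * t1) / N),
    ((s1 ^+ 2 + s2 ^+ 2 - t1 ^+ 2 - t2 ^+ 2) / N).
  rewrite Re_dot_pauli sqnorm_pauli sqnorm_image_pauli -/N.
  by split; rewrite /N; field.
(* Conversely, a vector lying over n under the Hopf map attains the given point. *)
case=> n1 [n2 [n3 [/hopf_surjective n_lift xE zE]]].
have [s1 [s2 [t1 [t2 /= [N0 n1E n2E n3E]]]]] := n_lift.
exists ((s1 +i* s2) *: e1 + (t1 +i* t2) *: e2).
  apply: contraNneq N0 => u0.
  by rewrite -sqnorm_pauli u0 /sqnorm linear0r.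
rewrite Re_dot_pauli sqnorm_pauli sqnorm_image_pauli -n1E -n2E -n3E.
rewrite -[x](subrK a0) -[z](subrK h) xE zE.
by congr (_, _); field.
Qed.

Lemma posdefmx_pauli : ~ normal_op f A -> posdefmx (ulsubmx (Qmx f A)).
Proof.
move=> nA; have D_gt0 := gram_gt0 nA; split.
  by rewrite trmx_ulsub tr_Qmx.
move=> w w0; rewrite Qmx_block_pauli mulr_gt0 ?ltr0n //.
apply: quadratic_gt0 => //; first by rewrite !addr_ge0 ?sqr_ge0.
apply: contraNT w0; rewrite negb_or !negbK => /andP[/eqP w00 /eqP w10].
apply/eqP/colP => i; rewrite mxE.
by case: i => [[|[|//]] ?]; [rewrite -[RHS]w00|rewrite -[RHS]w10];
  congr (w _ _); apply: val_inj.
Qed.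

End Pauli.

(** The a_k are the coordinates of the Hermitian part and the b_k those of the skew-Hermitian part
    divided by i, so half-sums and half-differences of entries solve the system. *)
Lemma pauli_coordinates (R : realType) (m11 m12 m21 m22 : R[i]) :
  exists a0 a1 a2 a3 b0 b1 b2 b3 : R,
   [/\ m11 = (a0 + a3) +i* (b0 + b3), m12 = (a1 - b2) +i* (a2 + b1),
       m21 = (a1 + b2) +i* (b1 - a2) & m22 = (a0 - a3) +i* (b0 - b3)].
Proof.
case: m11 m12 m21 m22 => [x11 y11] [x12 y12] [x21 y21] [x22 y22].
exists ((x11 + x22) / 2), ((x12 + x21) / 2), ((y12 - y21) / 2),
  ((x11 - x22) / 2), ((y11 + y22) / 2), ((y12 + y21) / 2),
  ((x21 - x12) / 2), ((y11 - y22) / 2).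
by split; congr (_ +i* _); field.
Qed.

Theorem theorem5p4 (R : realType) (V : vectType R[i])
    (f : {dot V for Num.conj}) (A : 'End(V)) :
  \dim {:V} = 2%N ->
  ~ normal_op f A ->
  DWR_pCK f A =
    [set p : R * R |
       ((homog p.1 p.2)^T *m Qmx f A *m homog p.1 p.2) 0 0 <= 0]
  /\ posdefmx (ulsubmx (Qmx f A)).
Proof.
move=> dimV nA; have [e1 [e2 on]] := orthonormal2_exists f dimV.
have [a0 [a1 [a2 [a3 [b0 [b1 [b2 [b3 [m11 m12 m21 m22]]]]]]]]] :=
  pauli_coordinates (f (A e1) e1) (f (A e1) e2) (f (A e2) e1) (f (A e2) e2).
split; first exact: (DWR_pCK_pauli dimV on m11 m12 m21 m22).
exact: (posdefmx_pauli dimV on m11 m12 m21 m22).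
Qed.
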